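(* Let $f_0:\mathbb{Z}\to\mathbb{N}$ be a starting configuration (a map with finite support contained in $2\mathbb{Z}$ or in $2\mathbb{Z}+1$), and let $g_0=f_0$. Let $(f_t)_{t\ge 0}$ and $(g_t)_{t\ge 0}$ be the evolutions of the liar machine started from $f_0$ and of the linear machine started from $g_0$, respectively. Then $$|f_t(j)-g_t(j)|<12\log t$$ for all integers $t\ge 2$ and all $j\in\mathbb{Z}$.
   Context: $\mathbb{N}=\{0,1,2,\dots\}$; $\log$ is the natural logarithm. Liar machine: given $f_t:\mathbb{Z}\to\mathbb{N}$ with finite support, define $\chi_t:\mathbb{Z}\to\{-1,0,1\}$ by $\chi_t(j)=0$ if $f_t(j)$ is even and $\chi_t(j)=(-1)^{\sum_{i<j}\chi_t(i)}$ if $f_t(j)$ is odd (so $\chi_t$ alternates $+1,-1,+1,\dots$ from left to right along the sites with an odd number of chips). Then $$f_{t+1}(j)=\frac{f_t(j-1)+f_t(j+1)+\chi_t(j-1)-\chi_t(j+1)}{2}.$$ (In words: at each site with $k$ chips, $\lfloor k/2\rfloor$ chips move one step left and $\lfloor k/2\rfloor$ move one step right; the leftover chips at sites with odd $k$ are sent alternately right, left, right, ... reading from left to right.) Linear machine: given $g_t:\mathbb{Z}\to\mathbb{R}$, define $g_{t+1}(j)=\frac{g_t(j-1)+g_t(j+1)}{2}$. *)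

(* Defs.v *)
From HB Require Import structures.
From mathcomp Require Import all_boot all_order all_algebra.
From mathcomp Require Import all_classical all_reals all_analysis.
From mathcomp Require Import zify ring lra.

Set Implicit Arguments.
Unset Strict Implicit.
Unset Printing Implicit Defensive.

Import Order.TTheory GRing.Theory Num.Theory.

Local Open Scope classical_set_scope.
Local Open Scope ring_scope.

Definition starting_configuration (f : int -> nat) : Prop :=
  finite_set [set j | f j != 0%N] /\
  ((forall j, f j != 0%N -> (2 %| j)%Z) \/
   (forall j, f j != 0%N -> ~~ (2 %| j)%Z)).

(* The sum runs over an infinite set and is the finitely supported sum of
   fsbigop: when f has finite support, so has chi, and the sum is the honest
   one.  It occurs as an int exponent of -1. *)
Definition liar_sign (f : int -> nat) (chi : int -> int) : Prop :=
  forall j : int,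
    chi j = if odd (f j) then (-1) ^ (\sum_(i \in [set i : int | i < j]) chi i)
            else 0.

(* The division is the exact one, in rat. *)
Definition liar_step (f f' : int -> nat) : Prop :=
  exists2 chi : int -> int, liar_sign f chi &
    forall j : int,
      (f' j)%:R = ((f (j - 1))%:R + (f (j + 1))%:R
                   + (chi (j - 1))%:~R - (chi (j + 1))%:~R) / 2 :> rat.

Definition liar_evolution (f0 : int -> nat) (f : nat -> int -> nat) : Prop :=
  f 0%N =1 f0 /\ forall t, liar_step (f t) (f t.+1).

Definition linear_evolution (R : realType) (g0 : int -> R)
    (g : nat -> int -> R) : Prop :=
  g 0%N =1 g0 /\
  forall t j, g t.+1 j = (g t (j - 1) + g t (j + 1)) / 2.

(* The lemmas below show that the relational liar machine is never vacuous:
   every finitely supported configuration has an evolution. *)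
Lemma liar_sign_exists (f : int -> nat) :
  finite_set [set j | f j != 0%N] -> exists chi, liar_sign f chi.
Proof.
move=> /finite_seqP[s0 s0E]; pose s := undup s0.
have sf i : (i \in s) = (f i != 0%N).
  rewrite mem_undup; apply/idP/idP => h.
    by have : [set` s0] i by []; rewrite -s0E.
  by have : [set j | f j != 0%N] i by []; rewrite s0E.
pose c j := count (fun i => (i < j) && odd (f i)) s.
pose chi j : int := if odd (f j) then (-1) ^+ c j else 0.
exists chi => j; rewrite {1}/chi; case: ifP => // _.
have -> : \sum_(i \in [set i : int | i < j]) chi i = \sum_(i <- s | i < j) chi i.
  rewrite (fsbigE [seq i <- s | i < j]) ?filter_uniq ?undup_uniq//.
  - rewrite big_filter_cond; apply: eq_bigl => i.
    by case ij : (i < j) => //=; exact: mem_set.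
  - by move=> i /=; rewrite mem_filter => /andP[].
  - move=> i /= ij; rewrite mem_filter ij /= sf negbK => /eqP fi0.
    by rewrite /chi fi0.
have sign_chi i : (-1) ^ chi i = (-1) ^+ odd (f i) :> int.
  by rewrite /chi; case: (odd _) => //; rewrite -signr_odd; case: (odd _).
rewrite {1}/c; move: (chi) sign_chi => {c sf}chi sign_chi.
elim: s => [|i s IH] /=; first by rewrite big_nil.
rewrite big_cons exprD IH; case: (i < j) => //=; last by rewrite mul1r.
by rewrite exprzDr // sign_chi.
Qed.

Lemma liar_step_exists (f : int -> nat) :
  finite_set [set j | f j != 0%N] ->
  exists2 f', liar_step f f' & finite_set [set j | f' j != 0%N].
Proof.
move=> fin; have [chi fchi] := liar_sign_exists fin.
have chiE j : chi j = 0 /\ ~~ odd (f j) \/ odd (f j) /\ (chi j = 1 \/ chi j = -1).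
  rewrite fchi; case: (odd _); [right; split=> // | by left].
  by case: (\sum_(i \in _) _) => n; rewrite /exprz -signr_odd;
    case: (odd _); [right | left | right | left].
pose h j : int := (f (j - 1))%:Z + (f (j + 1))%:Z + chi (j - 1) - chi (j + 1).
pose f' j := `|(h j %/ 2)%Z|%N.
have f'E j : h j = (f' j)%:Z * 2.
  by rewrite /f' /h; have := chiE (j - 1); have := chiE (j + 1); lia.
exists f'.
  exists chi => // j; have := congr1 (fun z : int => z%:~R : rat) (f'E j).
  rewrite /h intrM !intrD intrN /= !pmulrn => ->.
  by rewrite mulfK.
have fin2 : finite_set ((fun j => j + 1) @` [set j | f j != 0%N]
      `|` (fun j => j - 1) @` [set j | f j != 0%N]).
  by rewrite finite_setU; split; apply: finite_image.
apply: sub_finite_set fin2 => j /= f'j.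
have [fj|fj] := eqVneq (f (j - 1)) 0%N; last by left; exists (j - 1); rewrite ?subrK.
right; exists (j + 1); last by rewrite addrK.
apply: contra f'j => /eqP fj'; have := f'E j; have := chiE (j - 1).
have := chiE (j + 1).
rewrite /h fj fj' /= => -[[-> _]|[]//] [[-> _]|[]//].
by rewrite !addr0 => /eqP; rewrite eq_sym mulf_eq0 orbF.
Qed.

Lemma liar_evolution_exists (f0 : int -> nat) :
  finite_set [set j | f0 j != 0%N] -> exists f, liar_evolution f0 f.
Proof.
move=> fin0; pose T := {f : int -> nat | finite_set [set j | f j != 0%N]}.
have next (x : T) : {y : T | liar_step (sval x) (sval y)}.
  apply: cid; have [f' xf' fin'] := liar_step_exists (svalP x).
  by exists (exist _ f' fin').
exists (fun t => sval (iter t (fun x => sval (next x)) (exist _ f0 fin0))).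
by split => // t; exact: (svalP (next _)).
Qed.

(* Main.v *)
Require Import Defs.
From mathcomp Require Import all_boot all_order all_algebra.
From mathcomp Require Import all_classical all_reals all_analysis.
From mathcomp Require Import zify ring lra.

Set Implicit Arguments.
Unset Strict Implicit.
Unset Printing Implicit Defensive.

Import Order.TTheory GRing.Theory Num.Theory.

Local Open Scope ring_scope.

(** The linear machine iterates the averaging operator [avg], so [iter n avg u x]
    is the expectation of [u] at a simple random walk started at [x] after [n]
    steps.  The liar machine differs from it at each step by
    (chi (j - 1) - chi (j + 1)) / 2.  By parity, chi lives on one residue class
    modulo 2; put T = partial sum of chi on the other class and T = 0 on the
    class of chi.  Since chi alternates and starts with +1, T takes values in
    {0, 1}, and the error is a second difference of T with step 2, namely
    2 (T - avg (avg T)) ([liar_step_avg]).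

    By linearity an error made n + 1 steps before the time of observation
    contributes 2 (avg^n T - avg^(n+2) T) ([avg_superposition]).  With
    N = n + 2 and X the displacement of the walk after N steps, the commutation
    relation between [avg] and multiplication by the position
    ([iter_avg_scale_by_pos]) gives, for every h,

       E[(X^2 - N) h(x + X)] = N (N - 1) (avg^N h - avg^(N-2) h)(x).

    As E[X^2] = N, the left side is at most 2 N in absolute value when
    |h| <= 1, hence |avg^N h - avg^(N-2) h| <= 2 / (N - 1)
    ([iter_avg_two_steps]).  The contributions therefore add up to at most
    4 (1 + 1/2 + ... + 1/t), and the harmonic sum is below 3 ln t for t >= 2. *)

(** * Random walk averages *)

Section Averaging.
Variable R : realFieldType.
Implicit Types (u v h : int -> R) (x y : int).

Definition avg u y : R := (u (y - 1) + u (y + 1)) / 2.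

Definition sdiff u y : R := (u (y + 1) - u (y - 1)) / 2.

Definition scale_by_pos x u y : R := (y - x)%:~R * u y.

Lemma iter_avg_linear n (a : R) u v :
  iter n avg (fun y => a * u y + v y) =
  fun y => a * iter n avg u y + iter n avg v y.
Proof.
by elim: n => //= n ->; apply/funext => y; rewrite /avg; field.
Qed.

Lemma iter_avg_cst n (c : R) : iter n avg (fun=> c) = fun=> c.
Proof. by elim: n => //= n ->; apply/funext => y; rewrite /avg; field. Qed.

Lemma ler_norm_iter_avg n u v :
  (forall y, `|u y| <= v y) -> forall y, `|iter n avg u y| <= iter n avg v y.
Proof.
move=> uv; elim: n => //= n IH y; rewrite /avg normrM normfV (@ger0_norm _ 2)//.
by rewrite ler_pM2r ?invr_gt0// (le_trans (ler_normD _ _)) ?lerD.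
Qed.

Lemma ler_norm_iter_avg1 n u :
  (forall y, `|u y| <= 1) -> forall y, `|iter n avg u y| <= 1.
Proof.
by move=> u1 y; have := ler_norm_iter_avg n u1 y; rewrite iter_avg_cst.
Qed.

Lemma avg_sdiff u : avg (sdiff u) = sdiff (avg u).
Proof.
by apply/funext => y; rewrite /avg /sdiff !(addrK, subrK); field.
Qed.

Lemma sdiff2 u : sdiff (sdiff u) = fun y => avg (avg u) y - u y.
Proof.
by apply/funext => y; rewrite /avg /sdiff !(addrK, subrK); field.
Qed.

Lemma avg_scale_by_pos x u y :
  avg (scale_by_pos x u) y = (y - x)%:~R * avg u y + sdiff u y.
Proof. by rewrite /avg /sdiff /scale_by_pos !intrD !mulrNz; field. Qed.

Lemma sdiff_scale_by_pos x u y :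
  sdiff (scale_by_pos x u) y = (y - x)%:~R * sdiff u y + avg u y.
Proof. by rewrite /avg /sdiff /scale_by_pos !intrD !mulrNz; field. Qed.

(** [avg] commutes with [sdiff], and its commutator with [scale_by_pos x] is
    [sdiff]; so the commutator of the power is n + 1 copies of [sdiff].  This is
    the discrete Stein identity of the random walk. *)
Lemma iter_avg_scale_by_pos n x u y :
  iter n.+1 avg (scale_by_pos x u) y =
  (y - x)%:~R * iter n.+1 avg u y + n.+1%:R * iter n avg (sdiff u) y.
Proof.
elim: n u y => [|n IH] u y; first by rewrite /= avg_scale_by_pos mul1r.
have -> : iter n.+2 avg (scale_by_pos x u) =
    iter n.+1 avg (fun z => 1 * scale_by_pos x (avg u) z + sdiff u z).
  rewrite iterSr; congr iter; apply/funext => z.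
  by rewrite avg_scale_by_pos mul1r.
rewrite iter_avg_linear IH -avg_sdiff -!iterSr mul1r.
by rewrite [in RHS]mulrS mulrDl mul1r -addrA [X in _ = _ + X]addrC.
Qed.

(** Evaluating at the centre [x] kills the terms with a factor [y - x] that the
    commutator leaves, and [sdiff2] turns the remaining second difference into
    averages. *)
Lemma iter_avg_second_moment n x h :
  iter n.+2 avg (scale_by_pos x (scale_by_pos x h)) x =
  n.+2%:R * iter n.+2 avg h x +
  n.+2%:R * n.+1%:R * (iter n.+2 avg h x - iter n avg h x).
Proof.
rewrite iter_avg_scale_by_pos subrr mul0r add0r.
have -> : sdiff (scale_by_pos x h) =
    fun y => 1 * scale_by_pos x (sdiff h) y + avg h y.
  by apply/funext => y; rewrite sdiff_scale_by_pos mul1r.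
rewrite iter_avg_linear iter_avg_scale_by_pos subrr mul0r add0r mul1r -iterSr.
have -> : sdiff (sdiff h) = fun y => (-1) * h y + avg (avg h) y.
  by rewrite sdiff2; apply/funext => y; rewrite mulN1r addrC.
by rewrite iter_avg_linear -!iterSr; ring.
Qed.

(** In [iter_avg_second_moment] both terms other than the two-step difference
    are at most n + 2 in absolute value: the average of [h] because [avg] is a
    contraction, the left side because it is largest for [h = 1], when it is the
    variance n + 2 of the walk. *)
Lemma iter_avg_two_steps n h x : (forall y, `|h y| <= 1) ->
  `|iter n avg h x - iter n.+2 avg h x| <= 2 / n.+1%:R.
Proof.
move=> h1.
have n1 : 0 < n.+1%:R :> R by rewrite ltr0n.
have n2 : 0 < n.+2%:R :> R by rewrite ltr0n.
have var : iter n.+2 avg (scale_by_pos x (scale_by_pos x (fun=> 1))) x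
           = n.+2%:R.
  by rewrite iter_avg_second_moment !iter_avg_cst subrr mulr0 addr0 mulr1.
have hM : `|iter n.+2 avg (scale_by_pos x (scale_by_pos x h)) x| <= n.+2%:R.
  rewrite -[leRHS]var; apply: ler_norm_iter_avg => y.
  rewrite /scale_by_pos mulr1 mulrA normrM -expr2 ger0_norm ?sqr_ge0//.
  by rewrite ler_piMr ?sqr_ge0.
have hN : `|n.+2%:R * iter n.+2 avg h x| <= n.+2%:R.
  rewrite normrM (gtr0_norm n2) ler_piMr ?(ltW n2)//.
  exact: ler_norm_iter_avg1.
rewrite distrC ler_pdivlMr// -(ler_pM2l n2).
rewrite -{1}(gtr0_norm n1) -{1}(gtr0_norm n2) -!normrM.
have -> : n.+2%:R * ((iter n.+2 avg h x - iter n avg h x) * n.+1%:R) =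
    iter n.+2 avg (scale_by_pos x (scale_by_pos x h)) x
    - n.+2%:R * iter n.+2 avg h x.
  by rewrite iter_avg_second_moment; ring.
by rewrite (le_trans (ler_normB _ _))// mulr_natr mulr2n lerD.
Qed.

(** Superposition of the errors; the induction on time goes through because the
    bound is stated for all further averages of the discrepancy. *)
Lemma avg_superposition (e T : nat -> int -> R) :
  (forall j, e 0%N j = 0) ->
  (forall t j, `|T t j| <= 1) ->
  (forall t j, e t.+1 j = avg (e t) j + 2 * (T t j - avg (avg (T t)) j)) ->
  forall t j, `|e t j| <= 4 * \sum_(n < t) n.+1%:R^-1.
Proof.
move=> e0 T1 eS t j.
suff H m : `|iter m avg (e t) j| <= 4 * \sum_(n < t) (m + n).+1%:R^-1.
  exact: (H 0%N).
elim: t m j => [|t IH] m j.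
  have -> : e 0%N = fun=> 0 by apply/funext.
  by rewrite iter_avg_cst normr0 big_ord0 mulr0.
have -> : e t.+1 = fun y => 2 * ((-1) * avg (avg (T t)) y + T t y) + avg (e t) y.
  by apply/funext => y; rewrite eS; ring.
rewrite !iter_avg_linear -!iterSr big_ord_recl addn0 [leRHS]mulrDr.
apply: (le_trans (ler_normD _ _)); apply: lerD; last first.
  by apply: (le_trans (IH _ _)); under eq_bigr do rewrite addSnnS.
rewrite normrM mulN1r addrC ger0_norm//.
have -> : 4 / m.+1%:R = 2 * (2 / m.+1%:R) :> R by rewrite mulrA -natrM.
by rewrite ler_pM2l// iter_avg_two_steps.
Qed.

End Averaging.

(** * One step of the liar machine *)

Lemma starting_configuration_parity (f : int -> nat) :
  starting_configuration f -> exists b : bool,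
    forall j, f j != 0%N -> (2 %| j)%Z = b.
Proof.
case=> _ [ev|od]; first by exists true => j /ev.
by exists false => j /od /negbTE.
Qed.

Lemma liar_step_support (f f' : int -> nat) : liar_step f f' ->
  forall j, f' j != 0%N -> f (j - 1) != 0%N \/ f (j + 1) != 0%N.
Proof.
move=> [chi chiE f'E] j; have [fl|] := eqVneq (f (j - 1)) 0%N; last by left.
have [fr|] := eqVneq (f (j + 1)) 0%N; last by right.
have := f'E j; rewrite fl fr !chiE fl fr /= !addr0 mul0r => /eqP.
by rewrite pnatr_eq0 => ->.
Qed.

Lemma starting_configuration_step (f f' : int -> nat) :
  starting_configuration f -> liar_step f f' -> starting_configuration f'.
Proof.
move=> [fin par] /liar_step_support supp; split.
  have : finite_set ((fun j => j + 1) @` [set j | f j != 0%N]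
      `|` (fun j => j - 1) @` [set j | f j != 0%N])%classic.
    by rewrite finite_setU; split; apply: finite_image.
  apply: sub_finite_set => j /= /supp[fj|fj].
    by left; exists (j - 1); rewrite ?subrK.
  by right; exists (j + 1); rewrite ?addrK.
by case: par => par; [right | left] => j /supp[] /par; lia.
Qed.

(** [S j] is the sum of [chi] strictly to the left of [j].  Since the sign at
    [j] is (-1) ^ [S j], a sum equal to 0 can only move to 1 and a sum equal to
    1 only to 0; the induction starts to the left of the support. *)
Lemma liar_sign_partial_sum (f : int -> nat) (chi : int -> int) :
  finite_set [set j | f j != 0%N]%classic -> liar_sign f chi ->
  exists S : int -> int,
    (forall j, S (j + 1) = S j + chi j) /\ (forall j, S j = 0 \/ S j = 1).
Proof.
move=> /finite_seqP[s0 s0E] chiE; pose s := undup s0.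
have sf i : f i != 0%N -> i \in s.
  move=> fi; rewrite mem_undup; have : [set j | f j != 0%N]%classic i by [].
  by rewrite s0E.
have chi0 i : i \notin s -> chi i = 0.
  by move=> /(contra (sf i)); rewrite negbK chiE => /eqP ->.
pose S j := \sum_(i <- s | i < j) chi i.
have fsE j : \sum_(i \in [set i : int | i < j]%classic) chi i = S j.
  rewrite (fsbigE [seq i <- s | i < j]) ?filter_uniq ?undup_uniq//.
  - rewrite big_filter_cond; apply: eq_bigl => i.
    by case ij : (i < j) => //=; exact: mem_set.
  - by move=> i /=; rewrite mem_filter => /andP[].
  - by move=> i /= ij; rewrite mem_filter ij /= => /chi0.
have SS j : S (j + 1) = S j + chi j.
  rewrite /S (bigID (fun i => i == j)) /= addrC; congr (_ + _).
    by apply: eq_bigl => i; lia.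
  have -> : \sum_(i <- s | (i < j + 1) && (i == j)) chi i =
            \sum_(i <- s | i == j) chi i by apply: eq_bigl => i; lia.
  have [js|js] := boolP (j \in s).
    by rewrite -big_filter filter_pred1_uniq ?undup_uniq// big_seq1.
  by rewrite chi0// big1_seq// => i /andP[/eqP ->]; rewrite (negbTE js).
exists S; split => // j.
have [m Sm] : exists m : int, forall j, j <= m -> S j = 0.
  rewrite /S; elim: (s) => [|a r [m IH]]; first by exists 0 => i; rewrite big_nil.
  exists (Num.min a m) => i; rewrite le_min => /andP[ia im].
  by rewrite big_cons ifN ?IH// -leNgt.
have [/Sm|/ltW mj] := leP j m; first by left.
have -> : j = m + `|j - m|%N by lia.
elim: `|j - m|%N => [|n IH]; first by left; rewrite Sm// addr0.
have -> : m + n.+1 = m + n + 1 by lia.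
rewrite SS chiE fsE.
by case: IH => ->; case: odd; rewrite ?expr0z ?expr1z; [right|left|left|right].
Qed.

(** [T] is the partial sum of [chi] off the residue class that carries [chi].
    There a step of length 2 crosses exactly one site of the class, so [chi] is
    the increment of [T] over that step, and chi (j - 1) - chi (j + 1) is minus a
    second difference of [T].  Setting [T = 0] on the class itself makes the
    identity hold on the class too, where both sides vanish. *)
Lemma liar_step_avg (R : realFieldType) (f f' : int -> nat) :
  starting_configuration f -> liar_step f f' ->
  exists T : int -> R, (forall j, `|T j| <= 1) /\
    forall j, (f' j)%:R = avg (fun i => (f i)%:R) j
                          + 2 * (T j - avg (avg T) j).
Proof.
move=> fstart [chi chiE f'E].
have [b par] := starting_configuration_parity fstart.
have [S [SS S01]] := liar_sign_partial_sum fstart.1 chiE.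
exists (fun j => if (2 %| j)%Z == b then 0 else (S j)%:~R); split => j.
  case: ifP => _; first by rewrite normr0.
  by case: (S01 j) => ->; rewrite ?normr0 ?normr1.
have f'R : (f' j)%:R = avg (fun i => (f i)%:R) j
    + ((chi (j - 1))%:~R - (chi (j + 1))%:~R) / 2 :> R.
  have := congr1 (ratr : rat -> R) (f'E j).
  rewrite ratr_nat rmorphM fmorphV !rmorphD rmorphN/= !ratr_nat !ratr_int => ->.
  by rewrite /avg; field.
have chi0 i : (2 %| i)%Z != b -> chi i = 0.
  move=> ib; rewrite chiE; have [->//|/par ibE] := eqVneq (f i) 0%N.
  by rewrite ibE eqxx in ib.
rewrite f'R; congr (_ + _); rewrite {f'R}/avg !(addrK, subrK).
have pl : (2 %| j - 1 - 1)%Z = (2 %| j)%Z by lia.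
have pr : (2 %| j + 1 + 1)%Z = (2 %| j)%Z by lia.
rewrite pl pr; case: ifPn => jb.
  by rewrite !chi0; [rewrite !(subr0, addr0, mul0r, mulr0)|lia|lia].
(* Both [j] and [j - 2] lie off the class of [chi]. *)
have Sl : S j = S (j - 1 - 1) + chi (j - 1).
  rewrite -{1}[j](subrK 1) SS -{1}[j - 1](subrK 1) SS [chi (j - 1 - 1)]chi0 ?pl//.
  by rewrite addr0.
have Sr : S (j + 1 + 1) = S j + chi (j + 1) by rewrite !SS [chi j]chi0// addr0.
by rewrite Sr Sl !intrD; field.
Qed.

(** * Comparison with the linear machine *)

Lemma liar_linear_discrepancy (R : realType) (f0 : int -> nat)
    (f : nat -> int -> nat) (g : nat -> int -> R) :
  starting_configuration f0 -> liar_evolution f0 f ->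
  linear_evolution (fun j => (f0 j)%:R) g ->
  forall t j, `|(f t j)%:R - g t j| <= 4 * \sum_(n < t) n.+1%:R^-1.
Proof.
move=> start [f0E fS] [g0E gS].
have ft t : starting_configuration (f t).
  elim: t => [|t IH]; last exact: starting_configuration_step IH (fS t).
  by have /funext -> := f0E.
have [T TE] := choice (fun t => liar_step_avg R (ft t) (fS t)).
apply: (@avg_superposition _ (fun t j => (f t j)%:R - g t j) T) => [j|t j|t j].
- by rewrite f0E g0E subrr.
- exact: (TE t).1.
- by rewrite (TE t).2 gS /avg; field.
Qed.

Lemma ln_ge1BV (R : realType) (x : R) : 0 < x -> 1 - x^-1 <= ln x.
Proof.
move=> x0; have /le_ln1Dx : -1 < x^-1 - 1.
  by rewrite ltrBrDl subrr invr_gt0.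
by rewrite addrC subrK lnV ?posrE//; lra.
Qed.

Lemma harmonic_sum_lt_ln (R : realType) t : (2 <= t)%N ->
  \sum_(n < t) n.+1%:R^-1 < 3 * ln t%:R :> R.
Proof.
elim: t => // -[//|[_ _|t IH _]].
  (* ln 2 = ln (3/2) + ln (4/3) >= 1/3 + 1/4. *)
  have l32 := @ln_ge1BV R (3 / 2) ltac:(lra).
  have l43 := @ln_ge1BV R (4 / 3) ltac:(lra).
  have : ln (2 : R) = ln (3 / 2) + ln (4 / 3).
    by rewrite -lnM ?posrE; [congr ln; field|lra|lra].
  rewrite !invf_div in l32 l43.
  by rewrite !big_ord_recr big_ord0 /=; lra.
have t2 : 0 < t.+2%:R :> R by rewrite ltr0n.
have t3 : 0 < t.+3%:R :> R by rewrite ltr0n.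
have : t.+3%:R^-1 <= ln t.+3%:R - ln t.+2%:R :> R.
  have -> : t.+3%:R^-1 = 1 - (t.+3%:R / t.+2%:R)^-1 :> R.
    rewrite invf_div -{2}(divff (lt0r_neq0 t3)) -mulrBl -natrB//.
    by rewrite subSnn mul1r.
  by rewrite -ln_div ?posrE// ln_ge1BV// divr_gt0.
have : 0 < t.+3%:R^-1 :> R by rewrite invr_gt0.
rewrite big_ord_recr /=; move: (IH isT).
move: (\sum_(_ < _) _) (ln t.+3%:R) (ln t.+2%:R) (t.+3%:R^-1) => *; lra.
Qed.

Theorem theorem2 (R : realType) (f0 : int -> nat) (f : nat -> int -> nat)
    (g : nat -> int -> R)
    (hf0 : starting_configuration f0)
    (hf : liar_evolution f0 f)
    (hg : linear_evolution (fun j => (f0 j)%:R) g)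
    (t : nat) (ht : (2 <= t)%N) (j : int) :
  `|(f t j)%:R - g t j| < 12 * ln (t%:R : R).
Proof.
have := @liar_linear_discrepancy R f0 f g hf0 hf hg t j.
have := @harmonic_sum_lt_ln R t ht; lra.
Qed.
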